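(* Let $\mathcal P$ be a $\mathcal C$-transition system which is homogeneous w.r.t. a collection of shift operators $(\theta_U)_{U\in\mathcal A}$. Then the canonical $\mathcal C$-Markov process $X$ on $\Omega=E^{\mathcal A}$ with $\mathcal C$-transition system $\mathcal P$ satisfies $$\mathbb E_\nu[f(X\circ\theta_U)\mid\mathcal F_U]=\mathbb E_{X_U}[f(X)]\quad\mathbb P_\nu\text{-a.s.}$$ for any $U\in\mathcal A$, any measurable function $f:E^{\mathcal A}\to\mathbf R_+$ and any initial measure $\nu$.
   Context: Indexing collection. $\mathcal T$ is a locally compact metric space and $(E,d_E)$ is a locally compact separable metric space with Borel $\sigma$-field $\mathcal E$. The indexing collection $\mathcal A$ is a class of compact subsets of $\mathcal T$ such that: (i) $\mathcal A$ is closed under arbitrary intersections and $A^\circ\neq A$ for all $A\in\mathcal A$, $A\neq\mathcal T$; (ii) $\emptyset':=\bigcap_{A\in\mathcal A}A$ is nonempty; (iii) there is an increasing sequence $(B_n)_{n\in\mathbf N}$ in $\mathcal A$ with $\mathcal T=\bigcup_nB_n$; (iv) (Shape) if $A,A_1,\dots,A_k\in\mathcal A$ and $A\subseteq\bigcup_{i=1}^kA_i$ then $A\subseteq A_i$ for some $i$. Increments. $\mathcal A(u)$ is the class of (nonempty) finite unions of sets of $\mathcal A$, and $\mathcal C$ is the class of increments $C=A\setminus B$, $A\in\mathcal A$, $B\in\mathcal A(u)$. To $C$ one associates $A$ and $B$ with $C=A\setminus B$, $B\subseteq A$, $B=\bigcup_{i=1}^kA_i$ being the extremal representation ($A_i\in\mathcal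 A$, $A_i\not\subseteq A_j$ for $i\ne j$). Let $\mathcal A_\ell$ be the set of all intersections of nonempty subfamilies of $\{A_1,\dots,A_k\}$, and $\mathcal A_C=\{U\in\mathcal A_\ell;\ U\not\subseteq B^\circ\}=\{U_C^1,\dots,U_C^p\}$, $p=|\mathcal A_C|$. For a process $X$, $\mathbf X_C=(X_{U_C^1},\dots,X_{U_C^p})$; similarly $\mathbf x_C=(x_{U_C^1},\dots,x_{U_C^p})\in E^{|\mathcal A_C|}$. Filtrations. For a filtration $(\mathcal F_A)_{A\in\mathcal A}$ (always supposed complete), $\mathcal F_B=\bigvee_{A\in\mathcal A,A\subseteq B}\mathcal F_A$ for $B\in\mathcal A(u)$, and $\mathcal G^*_C=\bigvee_{B\in\mathcal A(u),\,B\cap C=\emptyset}\mathcal F_B$ for $C\in\mathcal C$. $\mathcal C$-Markov property. An $E$-valued process $X=\{X_A;A\in\mathcal A\}$ is $\mathcal C$-Markov w.r.t. $(\mathcal F_A)$ if it is adapted and, for all $C=A\setminus B\in\mathcal C$ and all bounded measurable $f:E\to\mathbf R$, $\mathbb E[f(X_A)\mid\mathcal G^*_C]=\mathbb E[f(X_A)\mid\mathbf X_C]$ a.s. $\mathcal C$-transition system. A collection $\mathcal P=\{P_C(\mathbf x_C;\mathrm dx_A);C\in\mathcal C\}$ such that: 1. for all $C\in\mathcal C$, $P_C$ is a transition probability from $E^{|\mathcal A_C|}$ to $(E,\mathcal E)$; 2. $P_\emptyset(x;\Gamma)=\delta_x(\Gamma)$; 3. (Chapman–Kolmogorov) for all $C=A\setminus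 B\in\mathcal C$ and $A'\in\mathcal A$, with $C'=C\cap A'$ and $C''=C\setminus A'$, $P_C(\mathbf x_C;\Gamma)=\int_EP_{C'}(\mathbf x_{C'};\mathrm dx_{A'})P_{C''}(\mathbf x_{C''};\Gamma)$ for all $\mathbf x_C,\mathbf x_{C'},\mathbf x_{C''}$ and $\Gamma\in\mathcal E$. Here components of the three vectors indexed by the same set of $\mathcal A$ are equal; when $A'\subseteq A$ and $A'\not\subseteq B$ one has $A'\in\mathcal A_{C''}$, and the component $x_{A'}$ of $\mathbf x_{C''}$ is the integration variable. If $A'\subseteq B$ or $A\subseteq A'$ the equation is trivially true; if $A'\not\subseteq A$, $A'$ is to be read as $A\cap A'$. Canonical process. $\Omega=E^{\mathcal A}$ with the $\sigma$-field $\mathcal F$ generated by coordinates, $X_A(\omega)=\omega(A)$, $(\mathcal F_A)$ is the natural filtration $\mathcal F_A=\sigma(\{X_V;V\subseteq A,V\in\mathcal A\})$ (completed). For a probability measure $\nu$ on $(E,\mathcal E)$, $\mathbb P_\nu$ is the unique probability measure on $(\Omega,\mathcal F)$ under which $X$ is $\mathcal C$-Markov w.r.t. $(\mathcal F_A)$ with $X_{\emptyset'}\sim\nu$ and $\mathbb P_\nu(X_A\in\Gamma\mid\mathcal G^*_C)=P_C(\mathbf X_C;\Gamma)$ a.s. for all $C=A\setminus B\in\mathcal C$, $\Gamma\in\mathcal E$. $\mathbb E_\nu$ is the expectation under $\mathbb P_\nu$, $\mathbb E_x=\mathbb E_{\delta_x}$ for $x\in E$, and $\mathbb E_{X_U}[f(X)]$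 is the function $x\mapsto\mathbb E_x[f(X)]$ evaluated at $X_U$. Shift operators. A collection $(\theta_U)_{U\in\mathcal A}$ of maps $\theta_U:\mathcal A\to\mathcal A$ such that: (i) for any $U\in\mathcal A$ with $U^\circ\ne\emptyset$, $A\subset(\theta_U(A))^\circ$ for all $A\in\mathcal A$; (ii) for any $A\in\mathcal A$, $U\mapsto\theta_U(A)$ is increasing and monotone outer-continuous, with $\theta_{\emptyset'}(A)=A$; (iii) for any $U\in\mathcal A$, $\theta_U$ is stable under intersections and $\theta_U(\emptyset')=U$. They are extended by $\theta_U(B)=\bigcup_{i=1}^k\theta_U(A_i)$ for $B=\bigcup_{i=1}^kA_i\in\mathcal A(u)$ and $\theta_U(C)=\theta_U(A)\setminus\theta_U(B)$ for $C=A\setminus B\in\mathcal C$. $X\circ\theta_U$ denotes the process $A\mapsto X_{\theta_U(A)}$. Homogeneity. $\mathcal P$ is homogeneous w.r.t. $(\theta_U)_{U\in\mathcal A}$ if for all $U\in\mathcal A$ and $C=A\setminus B\in\mathcal C$, $P_C(\mathbf x_C;\mathrm dx_A)=P_{\theta_U(C)}(\mathbf x_{\theta_U(C)};\mathrm dx_{\theta_U(A)})$, i.e. the two kernels coincide when the component of index $V$ of $\mathbf x_C$ is identified with the component of index $\theta_U(V)$ of $\mathbf x_{\theta_U(C)}$. *)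

(* Defs.v *)
From HB Require Import structures.
From mathcomp Require Import all_boot all_order all_algebra.
From mathcomp Require Import all_classical all_reals all_analysis.
From mathcomp Require Import measurable_realfun.

Set Implicit Arguments.
Unset Strict Implicit.
Unset Printing Implicit Defensive.
Import Order.TTheory GRing.Theory Num.Theory.
Import numFieldNormedType.Exports.

Local Open Scope classical_set_scope.
Local Open Scope ring_scope.

(* The library's measurable types are pointed; for a state space carrying a
   probability measure this is no restriction. *)
#[short(type="pmetricType")]
HB.structure Definition PointedMetric (K : numDomainType) :=
  {M of Pointed M & Metric K M}.

Definition separable_space (E : topologicalType) :=
  exists2 D : set E, countable D & dense D.

Definition borel (E : ptopologicalType) := g_sigma_algebraType (@open E).

(* J -> E with the product sigma-algebra *)
Definition pspace (J : Type) d (E : measurableType d) :=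
  g_sigma_algebraType
    (\bigcup_(j : J) preimage_set_system [set: J -> E] (@^~ j) measurable).

Record indexing_collection (R : realType) (T : metricType R) := {
  ic_set : set (set T) ;
  ic_compact : ic_set `<=` compact ;
  ic_bigcap : forall G : set (set T), G !=set0 -> G `<=` ic_set ->
    ic_set (\bigcap_(V in G) V) ;
  ic_interior : forall V, ic_set V -> V <> setT -> V° <> V ;
  ic_core : \bigcap_(V in ic_set) V !=set0 ;
  ic_exhaust : exists B : nat -> set T,
    [/\ forall n, ic_set (B n), forall n, B n `<=` B n.+1
      & \bigcup_n B n = setT] ;
  ic_shape : forall (V : set T) (F : set (set T)), ic_set V ->
    finite_set F -> F `<=` ic_set -> V `<=` \bigcup_(W in F) W ->
    exists2 W, F W & V `<=` W }.

Definition ic_type (R : realType) (T : metricType R)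
  (A : indexing_collection T) := set_type (ic_set A).

Section increments.
Context {R : realType} {T : metricType R} (A : indexing_collection T).
Local Notation I := (ic_type A).
Implicit Types (U V W : I) (B : set T) (F G : set I).

Lemma ic_typeP V : ic_set A (val V).
Proof. exact: set_mem (valP V). Qed.

Definition ic_mk (S : set T) (AS : ic_set A S) : I := SigSub (mem_set AS).

Lemma ic_nonempty : ic_set A !=set0.
Proof. by have [B [AB _ _]] := ic_exhaust A; exists (B 0%N). Qed.

Definition ic_bottom : I := ic_mk (ic_bigcap ic_nonempty (@subset_refl _ _)).

Lemma ic_setI V W : ic_set A (val V `&` val W).
Proof.
have -> : val V `&` val W = \bigcap_(S in [set val V; val W]) S.
  by rewrite bigcap_setU !bigcap_set1.
apply: ic_bigcap; first by exists (val V); left.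
by move=> _ [] ->; exact: ic_typeP.
Qed.

Definition ic_cap V W : I := ic_mk (ic_setI V W).

Definition finite_unions : set (set T) :=
  [set B | exists F,
    [/\ finite_set F, F !=set0 & B = \bigcup_(V in F) val V]].

(* An increment A \ B is given by A in the collection and a finite union B
   included in A: these are determined by the set A \ B when it is not empty
   (lemma increment_inj), while the empty increment has one representation
   A \ A for each A. *)
Record increment := Increment {
  itop : I ;
  ibot : set T ;
  ibot_fu : finite_unions ibot ;
  ibot_sub : ibot `<=` val itop }.
Implicit Types (C D : increment).

Definition iset C : set T := val (itop C) `\` ibot C.

Definition extremal_rep B F :=
  [/\ finite_set F, F !=set0, B = \bigcup_(V in F) val V
    & forall V W, F V -> F W -> val V `<=` val W -> V = W].

Definition meets_of_extremal B : set I :=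
  [set V | exists F G, [/\ extremal_rep B F, G !=set0, G `<=` F
                         & val V = \bigcap_(W in G) val W]].

(* For the empty increment A \ A the set below is {A}, so that the kernel P_C
   has a one-component argument x_A, as in P_C(x; .) = delta_x. The second
   disjunct only matters for A = B = T, the one member of the collection that
   may be open. *)
Definition inc_index C : set I :=
  [set V | meets_of_extremal (ibot C) V /\
    (~ (val V `<=` (ibot C)°) \/ iset C = set0)].

Lemma ic_cap_sub V W : val V `<=` val W -> ic_cap V W = V.
Proof. by move=> VW; apply: val_inj; exact: setIidl. Qed.

Lemma shape_ic V F : finite_set F ->
  val V `<=` \bigcup_(W in F) val W -> exists2 W, F W & val V `<=` val W.
Proof.
move=> finF VF.
have [|_ [W _ <-]|t /VF [W FW Wt]|_ [W FW <-] VW] :=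
    @ic_shape _ _ A (val V) (val @` F) (ic_typeP V).
- exact: finite_image.
- exact: ic_typeP.
- by exists (val W) => //; exists W.
- by exists W.
Qed.

Lemma increment_inj C D : iset C !=set0 -> iset C = iset D -> C = D.
Proof.
have sub C' D' : iset C' !=set0 -> iset C' = iset D' ->
    val (itop C') `<=` val (itop D').
  move=> [t [C't nC't]] CD.
  have [F [finF [V0 FV0] BF]] := ibot_fu C'.
  have [|s|W [->//|FW]] := @shape_ic (itop C') (itop D' |` F).
  - by rewrite finite_setU; split => //; exact: finite_set1.
  - have [BC's _|nBC's C's] := pselect (ibot C' s).
      by move: BC's; rewrite BF => -[W FW Ws]; exists W => //; right.
    exists (itop D'); first by left.
    by have [] : iset D' s by rewrite -CD.
  - by move=> CW; case: nC't; rewrite BF; exists W => //; exact: CW.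
move=> C0 CD; have D0 : iset D !=set0 by rewrite -CD.
have top : itop C = itop D.
  by apply: val_inj; apply/seteqP; split; exact: sub.
have bot : ibot C = ibot D.
  rewrite -(setIidr (@ibot_sub C)) -(setIidr (@ibot_sub D)) -!setDD.
  by rewrite -/(iset C) -/(iset D) CD top.
case: C D top bot {C0 D0 CD} => [a b fb sb] [a' b' fb' sb'] /= aa' bb'.
rewrite aa' bb' in sb fb *.
by congr Increment; exact: Prop_irrelevance.
Qed.

Lemma inter_inc_fu C V : finite_unions (ibot C `&` val V).
Proof.
have [F [finF [W FW] ->]] := ibot_fu C; exists (ic_cap^~ V @` F); split.
- exact: finite_image.
- by exists (ic_cap W V); exists W.
- by rewrite bigcup_image setI_bigcupl.
Qed.

Lemma inter_inc_sub C V : ibot C `&` val V `<=` val (ic_cap (itop C) V).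
Proof. exact: setSI (@ibot_sub C). Qed.

(* iset C `&` V *)
Definition inter_inc C V : increment :=
  Increment (inter_inc_fu C V) (@inter_inc_sub C V).

Lemma diff_inc_fu C V : finite_unions (ibot C `|` val (ic_cap (itop C) V)).
Proof.
have [F [finF _ ->]] := ibot_fu C.
exists (F `|` [set ic_cap (itop C) V]); split.
- by rewrite finite_setU; split => //; exact: finite_set1.
- by exists (ic_cap (itop C) V); right.
- by rewrite bigcup_setU bigcup_set1.
Qed.

Lemma diff_inc_sub C V :
  ibot C `|` val (ic_cap (itop C) V) `<=` val (itop C).
Proof. by rewrite subUset; split; [exact: ibot_sub|exact: subIsetl]. Qed.

(* iset C `\` V *)
Definition diff_inc C V : increment :=
  Increment (diff_inc_fu C V) (@diff_inc_sub C V).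

Lemma inter_incE C V : iset (inter_inc C V) = iset C `&` val V.
Proof.
by apply/seteqP; split => t /=; rewrite /iset /=; tauto.
Qed.

Lemma diff_incE C V : iset (diff_inc C V) = iset C `\` val V.
Proof.
by apply/seteqP; split => t /=; rewrite /iset /=; tauto.
Qed.

Record shift_operators := {
  shift_map :> I -> I -> I ;
  shift_interior : forall U V, (val U)° !=set0 ->
    val V `<=` (val (shift_map U V))° ;
  shift_mono : forall V U U', val U `<=` val U' ->
    val (shift_map U V) `<=` val (shift_map U' V) ;
  shift_outer_continuous : forall V (Un : nat -> I) U,
    (forall n, val (Un n.+1) `<=` val (Un n)) ->
    val U = \bigcap_n val (Un n) ->
    val (shift_map U V) = \bigcap_n val (shift_map (Un n) V) ;
  shift_bottom : forall V, shift_map ic_bottom V = V ;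
  shift_cap : forall U V W,
    shift_map U (ic_cap V W) = ic_cap (shift_map U V) (shift_map U W) ;
  shift_at_bottom : forall U, shift_map U ic_bottom = U }.

(* The union of the shifts of the members of any finite representation of B:
   see shift_unionE. *)
Definition shift_union (theta : shift_operators) U B : set T :=
  \bigcup_(V in [set V | val V `<=` B]) val (theta U V).

Lemma shift_sub (theta : shift_operators) U V W : val V `<=` val W ->
  val (theta U V) `<=` val (theta U W).
Proof.
by move=> VW; rewrite -(ic_cap_sub VW) shift_cap; exact: subIsetr.
Qed.

Lemma shift_unionE (theta : shift_operators) U F : finite_set F ->
  shift_union theta U (\bigcup_(V in F) val V) =
  \bigcup_(V in F) val (theta U V).
Proof.
move=> finF; apply/seteqP; split => t [V /= FV tV].
- have [W FW VW] := shape_ic finF FV.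
  by exists W => //; exact: shift_sub VW _ tV.
- by exists V => //= s Vs; exists V.
Qed.

Lemma shift_inc_fu (theta : shift_operators) U C :
  finite_unions (shift_union theta U (ibot C)).
Proof.
have [F [finF [V FV] ->]] := ibot_fu C; exists (theta U @` F); split.
- exact: finite_image.
- by exists (theta U V); exists V.
- by rewrite shift_unionE// bigcup_image.
Qed.

Lemma shift_inc_sub (theta : shift_operators) U C :
  shift_union theta U (ibot C) `<=` val (theta U (itop C)).
Proof.
move=> t [V /= VB]; apply: shift_sub; exact: subset_trans VB (@ibot_sub C).
Qed.

Definition shift_inc (theta : shift_operators) U C : increment :=
  Increment (@shift_inc_fu theta U C) (@shift_inc_sub theta U C).

End increments.

Section transition_systems.
Context {R : realType} {T : metricType R} (A : indexing_collection T).
Context {d : measure_display} (E : measurableType d).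
Local Notation I := (ic_type A).

Definition inc_restr (C : increment A) (x : I -> E) : pspace (inc_index C) E :=
  fun V => x (val V).
Arguments inc_restr : clear implicits.

(* Vectors x_C, x_C', ... whose components of equal index agree are written
   as restrictions of one configuration x : I -> E. *)
Record transition_system := {
  ts_kernel :> forall C : increment A, R.-pker (pspace (inc_index C) E) ~> E ;
  ts_empty : forall C x S, iset C = set0 -> measurable S ->
    ts_kernel C (inc_restr C x) S = \d_(x (itop C)) S ;
  ts_chapman_kolmogorov : forall C V x S, measurable S ->
    let V' := ic_cap (itop C) V in
    ts_kernel C (inc_restr C x) S =
    (\int[ts_kernel (inter_inc C V) (inc_restr (inter_inc C V) x)]_y
       ts_kernel (diff_inc C V)
         (inc_restr (diff_inc C V) [eta x with V' |-> y]) S)%E }.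

(* For x : I -> E, the component of index V of x \o theta U is the component
   of index theta U V of x. *)
Definition homogeneous (P : transition_system) (theta : shift_operators A) :=
  forall (U : I) (C : increment A) (x : I -> E) S, measurable S ->
    P C (inc_restr C (x \o theta U)) S =
    P (shift_inc theta U C) (inc_restr (shift_inc theta U C) x) S.

End transition_systems.
Arguments inc_restr {R T A d E} C x.

Section markov.
Context {R : realType} {T : metricType R} (A : indexing_collection T).
Context {d : measure_display} (E : measurableType d).
Context {dW : measure_display} (W : measurableType dW) (Q : probability W R).
Local Notation I := (ic_type A).
Implicit Types (G : set (set W)) (Fil : I -> set (set W)) (X : I -> W -> E).

(* Y is a version of the conditional expectation of Z given the sub-sigma-field
   G; Z is meant to be nonnegative or integrable. *)
Definition is_condexp G (Z Y : W -> \bar R) :=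
  (forall S : set (\bar R), measurable S -> G (Y @^-1` S)) /\
  (forall D, G D -> \int[Q]_(w in D) Y w = \int[Q]_(w in D) Z w)%E.

(* complete in the sense that it contains the Q-null events of W *)
Definition natural_filtration X (U : I) : set (set W) :=
  <<s (\bigcup_(V in [set V : I | val V `<=` val U])
         preimage_set_system setT (X V) measurable)
      `|` [set N | measurable N /\ Q N = 0%E] >>.

Definition filtration_union Fil (B : set T) : set (set W) :=
  <<s \bigcup_(V in [set V : I | val V `<=` B]) Fil V >>.

Definition filtration_star Fil (C : increment A) : set (set W) :=
  <<s \bigcup_(B in [set B | finite_unions A B /\ B `&` iset C = set0])
        filtration_union Fil B >>.

Definition sigma_inc X (C : increment A) : set (set W) :=
  preimage_set_system setT (fun w => inc_restr C (X^~ w)) measurable.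

(* Equality of the two conditional expectations is the existence of a common
   version. *)
Definition C_markov Fil X :=
  (forall V S, measurable S -> Fil V (X V @^-1` S)) /\
  (forall (C : increment A) (f : E -> R), measurable_fun setT f ->
     (exists M, forall x, `|f x| <= M) ->
     exists2 Y, is_condexp (sigma_inc X C) (fun w => (f (X (itop C) w))%:E) Y
       & is_condexp (filtration_star Fil C)
           (fun w => (f (X (itop C) w))%:E) Y).

End markov.

Section canonical.
Context {R : realType} {T : metricType R} (A : indexing_collection T).
Context {d : measure_display} (E : measurableType d).

Definition canonical_process (V : ic_type A) (w : pspace (ic_type A) E) : E := w V.

Definition canonical_filtration (Q : probability (pspace (ic_type A) E) R) :=
  natural_filtration Q canonical_process.

(* The characterization of the law P_nu of the canonical process. *)
Definition canonical_law (P : transition_system A E) (nu : probability E R)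
    (Q : probability (pspace (ic_type A) E) R) :=
  [/\ C_markov Q (canonical_filtration Q) canonical_process,
      (forall S, measurable S -> Q (canonical_process (ic_bottom A) @^-1` S) = nu S)
    & forall (C : increment A) S, measurable S ->
        is_condexp Q (filtration_star (canonical_filtration Q) C)
          (fun w => (\1_S (canonical_process (itop C) w))%:E)
          (fun w => P C (inc_restr C w) S)].

End canonical.

(* Main.v *)
Require Import Defs.
From HB Require Import structures.
From mathcomp Require Import all_boot all_order all_algebra.
From mathcomp Require Import all_classical all_reals all_analysis.
From mathcomp Require Import finmap measurable_realfun.
Set Implicit Arguments.
Unset Strict Implicit.
Unset Printing Implicit Defensive.
Import Order.TTheory GRing.Theory Num.Theory.
Import numFieldNormedType.Exports.
Import HBNNSimple.
Local Open Scope classical_set_scope.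
Local Open Scope ring_scope.

(* The identity is proved for f depending on the values at the members of a
   finite family L closed under intersections, adding the members of L one by
   one in an order compatible with inclusion. When V is added, the increment
   C = V minus the union of L has its vector x_C indexed by members of L. The
   Markov property for C under P_x replaces the value at V by P_C; the Markov
   property for the shifted increment under P_nu, conditionally on a sigma-field
   containing F_U, replaces it by the shifted kernel, which homogeneity
   identifies with P_C. Both sides thus reduce to a function of the values on L.
   Monotone class arguments extend this to all f, and yield the measurability of
   x |-> E_x[f] along the way. *)

(** * Induction over nonnegative measurable functions *)

Lemma nonneg_measurable_ind {R : realType} {d : measure_display}
    {Y : measurableType d} (Phi : (Y -> \bar R) -> Prop) :
  (forall S, measurable S -> Phi (fun y => (\1_S y)%:E)) ->
  (forall (c : R) h, 0 <= c -> Phi h -> Phi (fun y => c%:E * h y)%E) ->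
  (forall g h, Phi g -> Phi h -> Phi (fun y => g y + h y)%E) ->
  (forall (h_ : (Y -> \bar R)^nat) h, (forall n, Phi (h_ n)) ->
     (forall y, nondecreasing_seq (h_ ^~ y)) ->
     (forall y, h_ ^~ y @ \oo --> h y) -> Phi h) ->
  forall h : Y -> \bar R, measurable_fun setT h ->
    (forall y, 0 <= h y)%E -> Phi h.
Proof.
move=> Phi1 PhiZ PhiD Philim h mh h0.
pose g_ n y := (nnsfun_approx measurableT mh n y)%:E.
apply: (Philim g_).
- move=> n; set g := nnsfun_approx measurableT mh n.
  (* Absolute values make every coefficient nonnegative, whether or not membership in the range of
     [g] is remembered; on that range they change nothing. *)
  have -> : g_ n = fun y => (\sum_(c <- fset_set (range g))
      (`|c|%:E * (\1_(g @^-1` [set c]) y)%:E))%E.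
    apply/funext => y; rewrite /g_ -/g [in LHS](fimfunE g) fsbig_finite//= -sumEFin.
    rewrite big_seq [in RHS]big_seq; apply: eq_bigr => c.
    rewrite in_fset_set// => /set_mem[z _ <-].
    by rewrite EFinM ger0_norm.
  elim: (enum_fset (fset_set (range g))) => [|c s IH].
  + under eq_fun do rewrite big_nil.
    (* The empty sum is treated as the indicator of the empty set. *)
    have := Phi1 set0 measurable0; congr Phi.
    by apply/funext => y; rewrite indic0.
  + under eq_fun do rewrite big_cons.
    by apply: PhiD => //; apply: PhiZ => //; exact: Phi1.
- by move=> y m n mn; rewrite lee_fin; exact/lefP/nd_nnsfun_approx.
- by move=> y; exact: cvg_nnsfun_approx.
Qed.

Lemma measurable_fun_compTS {d1 d2 d3 : measure_display}
    {T1 : measurableType d1} {T2 : measurableType d2} {T3 : measurableType d3}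
    {g : T2 -> T3} {f : T1 -> T2} {D : set T1} :
  measurable_fun setT g -> measurable_fun setT f ->
  measurable_fun D (fun x => g (f x)).
Proof. by move=> mg mf; exact: measurable_funTS (measurableT_comp mg mf). Qed.

Lemma measurable_fun_indicE (R : realType) {d : measure_display}
    {Y : measurableType d} {A : set Y} :
  measurable A -> measurable_fun setT (fun y => (\1_A y)%:E : \bar R).
Proof. by move=> mA; apply/measurable_EFinP; exact: measurable_indic. Qed.

(** * Conditional expectations given by a family of probabilities *)

Section conditional_representation.
Context {R : realType} {dW dX dY : measure_display}.
Context {W : measurableType dW} {X : measurableType dX} {Y : measurableType dY}.
Context (Q : probability W R) (K : X -> probability Y R).
Context (xi : W -> X) (Z : W -> Y) (G : set (set W)).
Context (mxi : measurable_fun setT xi) (mZ : measurable_fun setT Z).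
Context (mG : G `<=` measurable).

(* E[h o Z | G] = K(xi; h), where G is a sub-sigma-field containing sigma(xi).
   The measurability of x |-> K(x; h) is part of the predicate: K is a mere
   family of probabilities. *)
Definition cond_repr (h : Y -> \bar R) :=
  [/\ measurable_fun setT h, (forall y, 0 <= h y)%E,
      measurable_fun setT (fun x => \int[K x]_y h y)%E
    & forall D, G D ->
        (\int[Q]_(w in D) h (Z w) = \int[Q]_(w in D) \int[K (xi w)]_y h y)%E].

Lemma cond_reprZ (c : R) h : 0 <= c -> cond_repr h ->
  cond_repr (fun y => c%:E * h y)%E.
Proof.
move=> c0 [mh h0 mKh Gh].
have KhE x : (\int[K x]_y (c%:E * h y) = c%:E * \int[K x]_y h y)%E.
  by rewrite ge0_integralZl_EFin.
split.
- exact: measurable_funeM.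
- by move=> y; rewrite mule_ge0// lee_fin.
- by under eq_fun do rewrite KhE; exact: measurable_funeM.
- move=> D GD; have mD := mG GD.
  under [RHS]eq_integral do rewrite KhE.
  rewrite !ge0_integralZl_EFin ?Gh//.
  + by move=> w _; exact: integral_ge0.
  + exact: measurable_fun_compTS mKh mxi.
  + exact: measurable_fun_compTS mh mZ.
Qed.

Lemma cond_reprD g h : cond_repr g -> cond_repr h ->
  cond_repr (fun y => g y + h y)%E.
Proof.
move=> [mg g0 mKg Gg] [mh h0 mKh Gh].
have KE x : (\int[K x]_y (g y + h y) = \int[K x]_y g y + \int[K x]_y h y)%E.
  by rewrite ge0_integralD.
split.
- exact: emeasurable_funD.
- by move=> y; rewrite adde_ge0.
- by under eq_fun do rewrite KE; exact: emeasurable_funD.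
- move=> D GD; have mD := mG GD.
  under [RHS]eq_integral do rewrite KE.
  rewrite [LHS]ge0_integralD// 1?[RHS]ge0_integralD// ?Gg ?Gh//.
  all: try by move=> w _; exact: integral_ge0.
  + exact: measurable_fun_compTS mKg mxi.
  + exact: measurable_fun_compTS mKh mxi.
  + exact: measurable_fun_compTS mg mZ.
  + exact: measurable_fun_compTS mh mZ.
Qed.

(** Monotone convergence under each [K x] makes the inner integrals increase to their limit; it then
    applies again under [Q]. Measurability in [x] passes to the pointwise limit. *)
Lemma cond_repr_lim (h_ : (Y -> \bar R)^nat) h :
  (forall n, cond_repr (h_ n)) -> (forall y, nondecreasing_seq (h_ ^~ y)) ->
  (forall y, h_ ^~ y @ \oo --> h y) -> cond_repr h.
Proof.
move=> Ph_ nd cv.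
have mh_ n : measurable_fun setT (h_ n) by have [] := Ph_ n.
have h_0 n y : (0 <= h_ n y)%E by have [] := Ph_ n.
have mKh_ n : measurable_fun setT (fun x => \int[K x]_y h_ n y)%E.
  by have [] := Ph_ n.
have hE y : limn (h_ ^~ y) = h y by exact: cvg_lim (cv y).
have mh : measurable_fun setT h.
  by apply: (emeasurable_fun_cvg h_) => // y _; exact: cv.
have cvK x : ((\int[K x]_y h_ n y) @[n --> \oo] --> \int[K x]_y h y)%E.
  under [X in _ --> X]eq_integral do rewrite -hE.
  by apply: cvg_monotone_convergence => // y _; exact: nd.
have ndK x : nondecreasing_seq (fun n => \int[K x]_y h_ n y)%E.
  by move=> m n mn; apply: ge0_le_integral => // y _; exact: nd.
split => //.
- move=> y; rewrite -hE; apply: lime_ge; last by near=> n; exact: h_0.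
  by apply/cvg_ex; exists (h y).
- exact: (emeasurable_fun_cvg (fun n x => \int[K x]_y h_ n y)%E).
- move=> D GD; have mD := mG GD.
  transitivity (limn (fun n => \int[Q]_(w in D) h_ n (Z w))%E).
    under eq_integral do rewrite -hE.
    apply: monotone_convergence => //.
    by move=> n; exact: measurable_fun_compTS (mh_ n) mZ.
  have GhE n : (\int[Q]_(w in D) h_ n (Z w) =
      \int[Q]_(w in D) \int[K (xi w)]_y h_ n y)%E.
    by have [_ _ _] := Ph_ n; exact.
  under eq_fun do rewrite GhE.
  rewrite -monotone_convergence//.
  + by apply: eq_integral => w _; exact: cvg_lim (cvK _).
  + move=> n; exact: measurable_fun_compTS (mKh_ n) mxi.
  + by move=> n w _; exact: integral_ge0.
Unshelve. all: by end_near. Qed.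

Lemma cond_repr1 : cond_repr (fun y => (\1_[set: Y] y)%:E).
Proof.
have KE x : (\int[K x]_y (\1_[set: Y] y)%:E = 1)%E.
  by rewrite integral_indic// setTI; exact: probability_setT.
split => //.
- exact: measurable_fun_indicE.
- by under eq_fun do rewrite KE; exact: measurable_cst.
- by move=> D GD; apply: eq_integral => w _; rewrite KE indicT.
Qed.

Lemma cond_reprC S : measurable S -> cond_repr (fun y => (\1_S y)%:E) ->
  cond_repr (fun y => (\1_(~` S) y)%:E).
Proof.
move=> mS [_ _ mK GS].
have mCS : measurable (~` S) by exact: measurableC.
have KE x : (\int[K x]_y (\1_(~` S) y)%:E = 1 - \int[K x]_y (\1_S y)%:E)%E.
  by rewrite !integral_indic// !setIT; exact: probability_setC.
have mKC : measurable_fun setT (fun x => \int[K x]_y (\1_(~` S) y)%:E)%E.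
  by under eq_fun do rewrite KE; exact: emeasurable_funB.
split => //.
- exact: measurable_fun_indicE.
- move=> D GD; have mD := mG GD.
  have K01 x : (0 <= \int[K x]_y (\1_S y)%:E <= 1)%E.
    by rewrite integral_indic// setIT measure_ge0 probability_le1.
  have fin : (\int[Q]_(w in D) (\1_S (Z w))%:E)%E \is a fin_num.
    have mZS : measurable (Z @^-1` S) by rewrite -[_ @^-1` _]setTI; exact: mZ.
    rewrite -[X in (\int[_]_(w in _) X w)%E]/(fun w => (\1_(Z @^-1` S) w)%:E).
    by rewrite integral_indic// fin_num_measure//; exact: measurableI.
  (* The integral of the indicator of [S] over [D] is finite, so it may be added to both sides; by
     the hypothesis on [S], both integrands then sum to the constant 1. *)
  rewrite -[LHS](addeK _ fin) -[RHS](addeK _ fin); congr (_ - _)%E.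
  rewrite [in RHS]GS// -[LHS]ge0_integralD// -1?[RHS]ge0_integralD//.
  + apply: eq_integral => w _; rewrite KE.
    rewrite subeK; last first.
      have /andP[K0 K1] := K01 (xi w).
      by rewrite ge0_fin_numE//; exact: le_lt_trans K1 (ltry _).
    by rewrite -EFinD !indicE in_setC; case: (Z w \in S); rewrite /= ?addr0 ?add0r.
  + by move=> w _; exact: integral_ge0.
  + exact: measurable_fun_compTS mKC mxi.
  + by move=> w _; have /andP[] := K01 (xi w).
  + exact: measurable_fun_compTS mK mxi.
  + exact: measurable_fun_compTS (@measurable_fun_indicE R _ _ _ mCS) mZ.
  + exact: measurable_fun_compTS (@measurable_fun_indicE R _ _ _ mS) mZ.
Qed.

Lemma cond_repr_bigcup (F : (set Y)^nat) : trivIset setT F ->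
  (forall n, cond_repr (fun y => (\1_(F n) y)%:E)) ->
  cond_repr (fun y => (\1_(\bigcup_n F n) y)%:E).
Proof.
move=> tF PF.
apply: (@cond_repr_lim (fun n y => \sum_(0 <= i < n) (\1_(F i) y)%:E)%E).
- elim=> [|n IH].
  + have := @cond_reprZ 0 _ (lexx _) cond_repr1; congr cond_repr.
    by apply/funext => y; rewrite big_nil mul0e.
  + by under eq_fun do rewrite big_nat_recr//=; exact: cond_reprD.
- move=> y m n mn; exact: lee_sum_nneg_natr.
- move=> y; rewrite indic_bigcup//; exact: is_cvg_nneseries.
Qed.

(** The pi-lambda theorem carries the property from [H] to indicators of events of the generated
    sigma-field, and induction over nonnegative functions does the rest. That sigma-field may be
    smaller than the one of [Y], which allows functions of only some of the coordinates. *)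
Lemma cond_repr_generated (H : set (set Y)) : setI_closed H ->
  H `<=` measurable ->
  (forall S, H S -> cond_repr (fun y => (\1_S y)%:E)) ->
  forall h : Y -> \bar R,
    measurable_fun [set: g_sigma_algebraType H] h ->
    (forall y, 0 <= h y)%E -> cond_repr h.
Proof.
move=> HI mH PH; apply: (@nonneg_measurable_ind _ _ (g_sigma_algebraType H)).
- apply: dynkin_induction => //.
  + exact: cond_repr1.
  + move=> S mS; apply: cond_reprC.
    move: S mS; apply: smallest_sub => //; exact: sigma_algebra_measurable.
  + by move=> F _ tF; exact: cond_repr_bigcup.
- by move=> c h c0; exact: cond_reprZ.
- exact: cond_reprD.
- exact: cond_repr_lim.
Qed.

End conditional_representation.

(** * Finite families closed under intersections *)

Section cap_closed_families.
Context {R : realType} {T : metricType R} (A : indexing_collection T).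
Local Notation I := (ic_type A).
Implicit Types (V W : I) (F L : set I).

(** The bottom member carries the initial law, and its shift by [U] is [U] itself, which links every
    such family to the sigma-field of the past. *)
Record cap_family L : Prop := CapFamily {
  cap_family_finite : finite_set L ;
  cap_family_bottom : L (ic_bottom A) ;
  cap_family_cap : forall V W, L V -> L W -> L (ic_cap V W) }.

Lemma ic_eqP V W : val V = val W -> V = W.
Proof. exact: val_inj. Qed.

Lemma ic_capC V W : ic_cap V W = ic_cap W V.
Proof. by apply: ic_eqP; exact: setIC. Qed.

Lemma ic_capA V W U : ic_cap V (ic_cap W U) = ic_cap (ic_cap V W) U.
Proof. by apply: ic_eqP; exact: setIA. Qed.

Lemma ic_cap_id V : ic_cap V V = V.
Proof. by apply: ic_eqP; exact: setIid. Qed.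

Lemma ic_bottom_sub V : val (ic_bottom A) `<=` val V.
Proof. by apply: bigcap_inf; exact: ic_typeP. Qed.

Lemma ic_cap_bottom V : ic_cap (ic_bottom A) V = ic_bottom A.
Proof. by apply: ic_cap_sub; exact: ic_bottom_sub. Qed.

Lemma cap_family_bottom_pair V : cap_family [set ic_bottom A; V].
Proof.
split; [exact: finite_set2|by left|].
move=> _ _ [] -> [] ->; rewrite ?(ic_capC V) ?ic_cap_bottom ?ic_cap_id;
  by [left|right].
Qed.

(** Adjoining the intersections of a member of [L1] with a member of [L2] is enough, because
    intersections can be regrouped. Directedness is what makes the cylinder events a pi-system. *)
Lemma cap_family_join L1 L2 : cap_family L1 -> cap_family L2 ->
  exists L, [/\ cap_family L, L1 `<=` L & L2 `<=` L].
Proof.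
move=> [fL1 bL1 cL1] [fL2 bL2 cL2].
pose J := L1 `|` L2 `|` [set ic_cap V W | V in L1 & W in L2].
have J1 V X : L1 V -> J X -> J (ic_cap V X).
  move=> LV [[LX|LX]|[V' LV' [W' LW' <-]]].
  - by left; left; exact: cL1.
  - by right; exists V => //; exists X.
  - by right; exists (ic_cap V V'); [exact: cL1|exists W'; rewrite ?ic_capA].
have J2 W X : L2 W -> J X -> J (ic_cap W X).
  move=> LW [[LX|LX]|[V' LV' [W' LW' <-]]].
  - by right; exists X => //; exists W; rewrite // ic_capC.
  - by left; right; exact: cL2.
  - right; exists V' => //; exists (ic_cap W W'); first exact: cL2.
    by rewrite !ic_capA (ic_capC V').
exists J; split; last 2 first.
- by move=> V L1V; left; left.
- by move=> V L2V; left; right.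
split.
- by rewrite !finite_setU; split => //; exact: finite_image2.
- by left; left.
- move=> X Y [[LX|LX]|[V LV [W LW <-]]] JY; [exact: J1|exact: J2|].
  by rewrite -ic_capA; apply: J1 => //; exact: J2.
Qed.

Lemma maximal_mem (s : seq I) V : exists2 M, M \in V :: s &
  forall W, W \in V :: s -> val M `<=` val W -> W = M.
Proof.
elim: s => [|X s [M Ms maxM]].
  by exists V; [exact: mem_head|move=> W; rewrite inE => /eqP].
have sub W : W \in [:: V, X & s] -> W = X \/ W \in V :: s.
  by rewrite !inE => /or3P[->|/eqP|->]; [right|left|rewrite orbT; right].
have [MX|nMX] := pselect (val M `<=` val X).
  exists X; first by rewrite !inE eqxx orbT.
  move=> W /sub[//|Ws] XW; apply: ic_eqP; apply/seteqP; split => //.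
  by rewrite (maxM W Ws)//; exact: subset_trans MX XW.
exists M; first by move: Ms; rewrite !inE => /orP[->|->]; rewrite ?orbT.
by move=> W /sub[->|Ws] MW; [case: nMX|exact: maxM].
Qed.

(** Removing a maximal member [M] keeps the family closed: if an intersection of two members equals
    [M], both contain [M] and hence equal it. Read backwards, this adds the members one at a
    time. *)
Lemma cap_family_ind (Phi : set I -> Prop) :
  Phi [set ic_bottom A] ->
  (forall L V, cap_family L -> (forall W, L W -> L (ic_cap V W)) ->
     Phi L -> Phi (V |` L)) ->
  forall L, cap_family L -> Phi L.
Proof.
move=> Phi0 PhiU L [/finite_seqP[s ->]].
have [n] := ubnP (size s); elim: n s => // n IH s sn bs cs.
have [M Ms maxM] : exists2 M, M \in s & forall W, W \in s ->
    val M `<=` val W -> W = M.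
  by case: s bs {sn cs} => // V s _; exact: maximal_mem.
pose s' := [seq W <- s | predC1 M W].
(* Every member contains the bottom, so a maximal bottom is the only member. *)
have [Mb|Mnb] := eqVneq M (ic_bottom A).
  suff -> : [set` s] = [set ic_bottom A] by [].
  apply/seteqP; split => [V /= Vs|V ->//].
  by rewrite -Mb; apply: maxM => //; rewrite Mb; exact: ic_bottom_sub.
have sE : [set` s] = M |` [set` s'].
  apply/seteqP; split => [V /= Vs|V].
    have [->|VM] := eqVneq V M; first by left.
    by right; rewrite /= mem_filter /= VM.
  by case=> [->//|]; rewrite /= mem_filter => /andP[].
have capM V W : V \in s -> ic_cap V W = M -> V = M.
  by move=> Vs VW; apply: maxM => //; rewrite -VW; exact: subIsetl.
have capF V W : V \in s -> V != M -> W \in s -> ic_cap V W \in s'.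
  move=> Vs VM Ws; rewrite mem_filter /= (cs V W)// andbT.
  by apply: contra VM => /eqP /(capM _ _ Vs) ->.
have cap_s' : cap_family [set` s'].
  split => /=.
  - exact: finite_seq.
  - by rewrite mem_filter /= eq_sym Mnb.
  - move=> V W; rewrite /= mem_filter => /andP[/= VM Vs].
    by rewrite mem_filter => /andP[_ Ws]; exact: capF.
rewrite sE; apply: PhiU => //.
  move=> W; rewrite /= mem_filter => /andP[/= WM Ws].
  by rewrite ic_capC; exact: capF.
apply: IH; [|exact: cap_family_bottom cap_s'|exact: cap_family_cap cap_s'].
rewrite -ltnS; apply: leq_trans sn.
rewrite ltnS size_filter -(count_predC (pred1 M)).
by rewrite -[X in (X < _)%N]add0n ltn_add2r -has_count has_pred1.
Qed.

Section new_member.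
Context (L : set I) (V : I).
Context (capL : cap_family L) (VL : forall W, L W -> L (ic_cap V W)).

Lemma new_member_inc_fu :
  finite_unions A (\bigcup_(W in L) val (ic_cap V W)).
Proof.
exists (ic_cap V @` L); split.
- by apply: finite_image; exact: cap_family_finite capL.
- by exists (ic_cap V (ic_bottom A)), (ic_bottom A) => //; case: capL.
- by rewrite bigcup_image.
Qed.

Lemma new_member_inc_sub : \bigcup_(W in L) val (ic_cap V W) `<=` val V.
Proof. by move=> t [W _ []]. Qed.

(** As a set this is [V] minus the union of [L]; intersecting with [V] first puts the removed union
    inside [V], as an increment requires. *)
Definition new_member_inc : increment A :=
  Increment new_member_inc_fu new_member_inc_sub.

Lemma cap_family_bigcap F W : finite_set F -> F !=set0 -> F `<=` L ->
  val W = \bigcap_(U in F) val U -> L W.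
Proof.
move=> /finite_seqP[s ->]; case: s => [[]//|U s] _ sL WE.
have [W' LW' W'E] : exists2 W', L W' & val W' = \bigcap_(U in [set` U :: s]) val U.
  elim: s sL {WE} => [|X s IH] sL.
    exists U; first by apply: sL; exact: mem_head.
    by rewrite set_cons1 bigcap_set1.
  have [|W' LW' W'E] := IH.
    move=> Y /= Ys; apply: sL; move: Ys.
    by rewrite /= !inE => /orP[->|->]; rewrite ?orbT.
  exists (ic_cap X W').
    by apply: (cap_family_cap capL) => //; apply: sL; rewrite /= !inE eqxx orbT.
  rewrite [LHS]/= W'E; apply/seteqP; split => t /=.
    move=> [Xt st] Y; rewrite /= !inE => /or3P[YU|/eqP->//|Ys]; apply: st.
      by rewrite /= inE YU.
    by rewrite /= inE Ys orbT.
  move=> st; split; first by apply: st; rewrite /= !inE eqxx orbT.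
  by move=> Y; rewrite /= inE => /orP[YU|Ys]; apply: st;
    rewrite /= !inE ?YU ?Ys ?orbT.
by rewrite (ic_eqP (etrans WE (esym W'E))).
Qed.

(** By Shape, an extremal component [U] of the removed union lies in some [ic_cap V X] with [X] in
    [L], which in turn lies in a component [Y]. Components being incomparable, all three coincide,
    so [U] is in [L], and so are the intersections of components. *)
Lemma inc_index_new_member : inc_index new_member_inc `<=` L.
Proof.
move=> W [[F [G [[finF _ /= BE antiF] G0 GF WE]]] _].
have FL : F `<=` L.
  move=> U FU.
  have UB : val U `<=` \bigcup_(W in ic_cap V @` L) val W.
    rewrite bigcup_image BE; exact: bigcup_sup.
  have [|_ [X LX <-] UX] := shape_ic _ UB.
    by apply: finite_image; exact: cap_family_finite capL.
  have XF : val (ic_cap V X) `<=` \bigcup_(W in F) val W.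
    by rewrite -BE => t ?; exists X.
  have [Y FY XY] := shape_ic finF XF.
  have UY : U = Y by apply: antiF => //; exact: subset_trans UX XY.
  suff -> : U = ic_cap V X by exact: VL.
  by apply: ic_eqP; apply/seteqP; split => //; rewrite UY.
apply: (cap_family_bigcap _ G0 _ WE); last exact: subset_trans GF FL.
exact: sub_finite_set GF finF.
Qed.

End new_member.

End cap_closed_families.

(** * Coordinate sigma-fields on the canonical space *)

Section coordinates.
Context {R : realType} {T : metricType R} (A : indexing_collection T).
Context {d : measure_display} (E : measurableType d).
Local Notation I := (ic_type A).
Local Notation Omega := (pspace I E).
Local Notation X := (@canonical_process R T A d E).
Implicit Types (L : set I) (V : I).

Definition coord_gen L : set (set Omega) :=
  \bigcup_(V in L) preimage_set_system setT (X V) measurable.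

Lemma measurable_canonical_process V : measurable_fun setT (X V).
Proof. by move=> _ S mS; apply: sub_sigma_algebra; exists V => //; exists S. Qed.

Lemma coord_gen_sub L : coord_gen L `<=` measurable.
Proof.
move=> _ [V _ [S mS <-]]; exact: measurable_canonical_process.
Qed.

Lemma coord_sigma_sub L : <<s coord_gen L >> `<=` @measurable _ Omega.
Proof.
apply: smallest_sub; first exact: sigma_algebra_measurable.
exact: coord_gen_sub.
Qed.

Lemma measurable_sub_gen (G H : set (set Omega)) (h : Omega -> \bar R) :
  G `<=` H -> measurable_fun [set: g_sigma_algebraType G] h ->
  measurable_fun [set: g_sigma_algebraType H] h.
Proof.
move=> GH mh _ S mS; have := mh measurableT _ mS.
exact: sub_sigma_algebra2.
Qed.

Lemma measurable_inc_restr L (C : increment A) : inc_index C `<=` L ->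
  measurable_fun [set: g_sigma_algebraType (coord_gen L)]
    (inc_restr C : (I -> E) -> pspace (inc_index C) E).
Proof.
move=> CL; apply: measurability; first by [].
move=> _ [_ [j _ [S mS <-]] <-]; apply: sub_sigma_algebra.
exists (val j); first by apply: CL; exact: set_valP.
by exists S => //; rewrite !setTI.
Qed.

Lemma natural_filtration_measurable (Q : probability Omega R) V :
  canonical_filtration Q V `<=` @measurable _ Omega.
Proof.
apply: smallest_sub; first exact: sigma_algebra_measurable.
move=> S [[W _ [B mB <-]]|[]//]; exact: measurable_canonical_process.
Qed.

Lemma natural_filtration_star (Q : probability Omega R) (C : increment A) V :
  val V `&` iset C = set0 ->
  canonical_filtration Q V `<=` filtration_star (canonical_filtration Q) C.
Proof.
move=> VC S FS; apply: sub_sigma_algebra; exists (val V).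
  split => //; exists [set V]; split; [exact: finite_set1|by exists V|].
  by rewrite bigcup_set1.
by apply: sub_sigma_algebra; exists V => /=.
Qed.

Lemma canonical_process_filtration (Q : probability Omega R) V S :
  measurable S -> canonical_filtration Q V (X V @^-1` S).
Proof.
move=> mS; apply: sub_sigma_algebra; left; exists V => //=.
by exists S => //; rewrite setTI.
Qed.

End coordinates.

(** * The Markov property at [U] for functions of the shifted path *)

Section markov_shift.
Context {R : realType} {T : metricType R} (A : indexing_collection T).
Context {d : measure_display} (E : measurableType d).
Local Notation I := (ic_type A).
Local Notation Omega := (pspace I E).
Local Notation X := (@canonical_process R T A d E).
Local Notation coord := (@coord_gen R T A d E).
Context (P : transition_system A E) (theta : shift_operators A).
Context (homP : homogeneous P theta).
Context (Pr : probability E R -> probability Omega R).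
Context (canPr : forall nu, canonical_law P nu (Pr nu)).
Context (U : I) (nu : probability E R).
Implicit Types (L : set I) (V : I) (h : Omega -> \bar R).

Definition shift_path (w : Omega) : Omega := fun V => X (theta U V) w.

Lemma measurable_shift_path : measurable_fun setT shift_path.
Proof.
apply: measurability; first by [].
move=> _ [_ [V _ [S mS <-]] <-].
have := @measurable_canonical_process _ _ A _ E (theta U V) measurableT _ mS.
by rewrite !setTI.
Qed.

Let FU := canonical_filtration (Pr nu) U.

Definition markov_at_shift h :=
  cond_repr (Pr nu) (fun x => Pr \d_x) (X U) shift_path FU h.

Let generated (H : set (set Omega)) : setI_closed H -> H `<=` measurable ->
  (forall S, H S -> markov_at_shift (fun w => (\1_S w)%:E)) ->
  forall h, measurable_fun [set: g_sigma_algebraType H] h ->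
    (forall w, 0 <= h w)%E -> markov_at_shift h.
Proof.
apply: cond_repr_generated.
- exact: measurable_canonical_process.
- exact: measurable_shift_path.
- exact: natural_filtration_measurable.
Qed.

Let markov_on L := forall h,
  measurable_fun [set: g_sigma_algebraType (coord L)] h ->
  (forall w, 0 <= h w)%E -> markov_at_shift h.

(** Under [Pr \d_x] the bottom value has law [\d_x], and the bottom value of the shifted path is the
    value at [U]; the two integrands agree pointwise. *)
Lemma markov_on_bottom : markov_on [set ic_bottom A].
Proof.
move=> h; apply: generated.
- move=> _ _ [_ -> [S mS <-]] [_ -> [S' mS' <-]].
  exists (ic_bottom A) => //; exists (S `&` S'); first exact: measurableI.
  by rewrite preimage_setI !setTI.
- exact: coord_gen_sub.
move=> _ [_ -> [S mS <-]]; rewrite setTI.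
have mXS : measurable (X (ic_bottom A) @^-1` S).
  by rewrite -[_ @^-1` _]setTI; exact: measurable_canonical_process.
have KE x : (\int[Pr \d_x]_w (\1_(X (ic_bottom A) @^-1` S) w)%:E = (\1_S x)%:E)%E.
  rewrite integral_indic// setIT.
  by have [_ law0 _] := canPr \d_x; exact: law0.
split.
- exact: measurable_fun_indicE.
- by move=> w; rewrite lee_fin.
- by under eq_fun do rewrite KE; exact: measurable_fun_indicE.
- move=> D _; apply: eq_integral => w _; rewrite KE.
  by rewrite -[in RHS](shift_at_bottom theta U).
Qed.

Lemma markov_on_new_member L V :
  cap_family L -> (forall W, L W -> L (ic_cap V W)) ->
  markov_on L -> markov_on (V |` L).
Proof.
move=> capL VL PhiL h.
pose C := new_member_inc V capL.
have CL : inc_index C `<=` L by exact: inc_index_new_member.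
have disj W : L W -> val W `&` iset C = set0.
  move=> LW; apply/seteqP; split => // t [Wt [Vt]]; apply.
  by exists W.
(* Shifts commute with intersections, so the shifts of [V] and [W] meet in the shift of
   [ic_cap V W], which is part of what is removed. *)
have disj_shift W : L W -> val (theta U W) `&` iset (shift_inc theta U C) = set0.
  move=> LW; apply/seteqP; split => // t [Wt [Vt]]; apply.
  exists (ic_cap V W); first by move=> s Ws; exists W.
  by rewrite shift_cap.
have star (Q : probability Omega R) : <<s coord L >> `<=`
    filtration_star (canonical_filtration Q) C.
  apply: smallest_sub; first exact: smallest_sigma_algebra.
  move=> _ [W LW [S mS <-]]; rewrite setTI.
  apply: (natural_filtration_star (disj _ LW)).
  exact: canonical_process_filtration.
pose GS := filtration_star (canonical_filtration (Pr nu)) (shift_inc theta U C).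
(* The bottom member of [L] shifts to [U], which is therefore disjoint from the shifted
   increment. *)
have starU : FU `<=` GS.
  apply: natural_filtration_star.
  by rewrite -(disj_shift _ (cap_family_bottom capL)) shift_at_bottom.
have star_shift S : <<s coord L >> S -> GS (shift_path @^-1` S).
  move=> LS; rewrite -[_ @^-1` _]setTI.
  move: S LS; apply: smallest_sub.
    by apply: sigma_algebra_image; exact: smallest_sigma_algebra.
  move=> _ [W LW [S mS <-]]; rewrite /image_set_system /= !setTI.
  apply: (natural_filtration_star (disj_shift _ LW)).
  exact: canonical_process_filtration.
have mgen S : <<s coord L >> S -> measurable S.
  exact: coord_sigma_sub.
pose H := [set S `&` X V @^-1` S' | S in <<s coord L >>
             & S' in measurable].
move=> mh; apply: (@generated H).
- move=> _ _ [S LS [S' mS' <-]] [B LB [B' mB' <-]].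
  exists (S `&` B); first
    exact: (@measurableI _ (g_sigma_algebraType (coord L))).
  exists (S' `&` B'); first exact: measurableI.
  by rewrite preimage_setI setIACA.
- move=> _ [S LS [S' mS' <-]]; apply: measurableI; first exact: mgen.
  by rewrite -[_ @^-1` _]setTI; exact: measurable_canonical_process.
- move=> _ [S LS [S' mS' <-]].
  set h' := fun w => (\1_(S `&` X V @^-1` S') w)%:E : \bar R.
  have mS := mgen _ LS.
  have mSV : measurable (S `&` X V @^-1` S').
    apply: measurableI => //.
    by rewrite -[_ @^-1` _]setTI; exact: measurable_canonical_process.
  (* The result of integrating out the value at [V]; by [CL] it depends only on the coordinates in
     [L], so the induction hypothesis applies to it. *)
  pose q (w : Omega) := ((\1_S w)%:E * P C (inc_restr C w) S')%E.
  have q0 w : (0 <= q w)%E by rewrite mule_ge0// lee_fin.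
  have mq : measurable_fun [set: g_sigma_algebraType (coord L)] q.
    apply: emeasurable_funM.
      exact: (@measurable_fun_indicE R _ (g_sigma_algebraType _)).
    have mP : measurable_fun setT (P C ^~ S') by exact: measurable_kernel.
    exact: measurable_fun_compTS mP (measurable_inc_restr CL).
  have [mq' _ mKq eq_q] := PhiL _ mq q0.
  have qE w : q w = ((fun w => P C (inc_restr C w) S') \_ S) w.
    rewrite patchE /q indicE; case: (w \in S); last by rewrite mul0e.
    by rewrite mul1e.
  have h'E w : h' w = ((fun w => (\1_S' (X V w))%:E : \bar R) \_ S) w.
    rewrite patchE /h' indicI /= [in LHS]indicE.
    by case: (w \in S); rewrite ?mul0r ?mul1r.
  (* Markov property of [C] under [Pr \d_x], tested on the event [S] of the conditioning
     sigma-field. *)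
  have KE x : (\int[Pr \d_x]_w h' w = \int[Pr \d_x]_w q w)%E.
    have [_ _ law] := canPr \d_x; have [_ lawC] := law C _ mS'.
    transitivity (\int[Pr \d_x]_(w in S) (\1_S' (X V w))%:E)%E.
      by rewrite [RHS]integral_mkcond; apply: eq_integral => w _; rewrite h'E.
    rewrite -[LHS]lawC; last exact: star.
    by rewrite [LHS]integral_mkcond; apply: eq_integral => w _; rewrite qE.
  split.
  - exact: measurable_fun_indicE.
  - by move=> w; rewrite lee_fin.
  - by under eq_fun do rewrite KE.
  - move=> D FD.
    under [RHS]eq_integral do rewrite KE.
    (* The induction hypothesis turns the right side into the integral of [q] along the shifted
       path. It remains to apply the Markov property of the shifted increment under [Pr nu], on an
       event combining [D] with the shifted [S], and to identify the kernels by [homP]. *)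
    rewrite -eq_q//.
    have [_ _ law] := canPr nu; have [_ lawC] := law (shift_inc theta U C) _ mS'.
    transitivity (\int[Pr nu]_(w in D `&` shift_path @^-1` S)
        (\1_S' (X (theta U V) w))%:E)%E.
      rewrite [RHS]integral_mkcondr; apply: eq_integral => w _.
      by rewrite h'E !patchE.
    rewrite -[LHS]lawC; last first.
      apply: (@measurableI _ (g_sigma_algebraType _)); first exact: starU.
      exact: star_shift.
    rewrite [LHS]integral_mkcondr; apply: eq_integral => w _.
    by rewrite qE !patchE -homP.
- apply: measurable_sub_gen mh => _ [W [->|LW] [S mS <-]].
  + exists setT; first
    exact: (@measurableT _ (g_sigma_algebraType (coord L))).
    by exists S.
  + exists (setT `&` X W @^-1` S).
      by apply: sub_sigma_algebra; exists W => //; exists S.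
    by exists setT => //; rewrite preimage_setT setIT.
Qed.

(** Events depending on some closed finite family form a pi-system by [cap_family_join]. It
    generates the whole sigma-field, as each coordinate [V] belongs to the family made of the bottom
    and [V]. *)
Lemma markov_at_shift_measurable h : measurable_fun setT h ->
  (forall w, 0 <= h w)%E -> markov_at_shift h.
Proof.
move=> mh.
have onL L : cap_family L -> markov_on L.
  apply: cap_family_ind; first exact: markov_on_bottom.
  exact: markov_on_new_member.
pose H := [set S | exists2 L, cap_family L & <<s coord L >> S].
apply: (@generated H).
- move=> S S' [L capL LS] [L' capL' LS'].
  have [M [capM LM LM']] := cap_family_join capL capL'.
  exists M => //.
  apply: (@measurableI _ (g_sigma_algebraType (coord M))).
  + by move: S LS; apply: sub_sigma_algebra2; exact: bigcup_subset.
  + by move: S' LS'; apply: sub_sigma_algebra2; exact: bigcup_subset.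
- by move=> S [L _]; exact: coord_sigma_sub.
- move=> S [L capL LS]; apply: (onL _ capL).
  exact: (@measurable_fun_indicE R _ (g_sigma_algebraType (coord L))).
  by move=> w; rewrite lee_fin.
- apply: measurable_sub_gen mh => _ [V _ [S mS <-]].
  exists [set ic_bottom A; V]; first exact: cap_family_bottom_pair.
  by apply: sub_sigma_algebra; exists V; [right|exists S].
Qed.

End markov_shift.

Theorem theorem2p4 (R : realType) (T : metricType R) (E : pmetricType R)
    (lcT : locally_compact [set: T])
    (lcE : locally_compact [set: E]) (sepE : separable_space E)
    (A : indexing_collection T)
    (P : transition_system A (borel E)) (theta : shift_operators A)
    (homP : homogeneous P theta)
    (Pr : probability (borel E) R ->
          probability (pspace (ic_type A) (borel E)) R)
    (canPr : forall nu, canonical_law P nu (Pr nu))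
    (U : ic_type A)
    (f : pspace (ic_type A) (borel E) -> R)
    (mf : measurable_fun [set: pspace (ic_type A) (borel E)] f)
    (f_ge0 : forall w, 0 <= f w)
    (nu : probability (borel E) R) :
  is_condexp (Pr nu) (canonical_filtration (Pr nu) U)
    (fun w => (f (fun V => canonical_process (theta U V) w))%:E)
    (fun w => 'E_(Pr \d_(canonical_process U w))[f])%E.
Proof.
have mh : measurable_fun setT (EFin \o f) by exact/measurable_EFinP.
have [_ _ mK eqD] := markov_at_shift_measurable homP canPr U nu mh f_ge0.
rewrite unlock; split => [S mS|D FD]; last exact/esym/eqD.
(* The candidate version is [g] evaluated at the value at [U], so measurability of [g] makes it
   measurable with respect to the past. *)
pose g x := (\int[Pr \d_x]_w (f w)%:E)%E.
have mgS : measurable (g @^-1` S) by rewrite -[_ @^-1` _]setTI; exact: mK.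
exact: canonical_process_filtration mgS.
Qed.
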